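(* Let $\mathcal{G}$ be a class of unit disk graphs. Then $\mathsf{D}^{\mathrm{Eq}}(\mathcal{G})=O(1)$ if and only if $\mathcal{G}$ is stable.
   Context: A graph class is a set of graphs closed under isomorphism. A graph $G$ is a unit disk graph if there is a map $\phi:V(G)\to\mathbb{R}^2$ with $xy\in E(G)$ iff $\|\phi(x)-\phi(y)\|_2<2$. Chain-index $\mathrm{ch}(G)$: the largest $k$ such that there are $2k$ distinct vertices $a_1,\dots,a_k,b_1,\dots,b_k$ with, for all $i<j$, $a_ib_j$ an edge and $b_ia_j$ a non-edge. $\mathcal{G}$ is stable if there is a constant $k$ with $\mathrm{ch}(G)\le k$ for all $G\in\mathcal{G}$. $\mathsf{D}^{\mathrm{Eq}}(M)$ for $M\in\{\pm1\}^{V\times V}$: the minimum depth of a rooted binary tree in which each internal node $v$ carries functions $\alpha_v,\beta_v:V\to\mathbb{N}$ and each leaf a value in $\{\pm1\}$, such that for every $(x,y)$, walking from the root (right child if $\alpha_v(x)=\beta_v(y)$, left otherwise) reaches a leaf with value $M(x,y)$. $\mathsf{D}^{\mathrm{Eq}}(\mathcal{G})=O(1)$ means there is a constant $c$ with $\mathsf{D}^{\mathrm{Eq}}(\mathrm{Adj}_G)\le c$ for all $G\in\mathcal{G}$, where $\mathrm{Adj}_G(x,y)=1$ iff $xy\in E(G)$ and $-1$ otherwise. *)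

(* Defs.v *)
From HB Require Import structures.
From mathcomp Require Import all_boot all_order all_algebra.
From mathcomp Require Import boolp reals.

Set Implicit Arguments.
Unset Strict Implicit.
Unset Printing Implicit Defensive.

Import Order.TTheory GRing.Theory Num.Theory.

Local Open Scope ring_scope.

Record sgraph := SGraph {
  vertex :> finType;
  edge : rel vertex;
  edge_sym : symmetric edge;
  edge_irrefl : irreflexive edge }.

Definition isomorphic (G H : sgraph) : Prop :=
  exists f : G -> H, bijective f /\ forall x y, edge (f x) (f y) = edge x y.

Record graph_class := GraphClass {
  in_class :> sgraph -> Prop;
  in_class_iso : forall G H, isomorphic G H -> in_class G -> in_class H }.

(* The norm `|_| that the library puts on row vectors is the sup norm. *)
Definition norm2 (R : realType) (n : nat) (u : 'rV[R]_n) : R :=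
  Num.sqrt (\sum_(i < n) u 0 i ^+ 2).

(* Graphs have no loops, so the condition only concerns distinct vertices. *)
Definition unit_disk (R : realType) (G : sgraph) : Prop :=
  exists phi : G -> 'rV[R]_2,
    forall x y : G, x != y -> edge x y <-> norm2 (phi x - phi y) < 2.

Definition has_chain (G : sgraph) (k : nat) : bool :=
  [exists a : k.-tuple G, exists b : k.-tuple G,
    uniq (a ++ b) &&
    [forall i : 'I_k, forall j : 'I_k, (i < j)%N ==>
      edge (tnth a i) (tnth b j) && ~~ edge (tnth b i) (tnth a j)]].

Lemma has_chain0 (G : sgraph) : exists k, has_chain G k.
Proof.
exists 0%N; apply/existsP; exists [tuple]; apply/existsP; exists [tuple] => /=.
by apply/forallP => -[].
Qed.

Lemma has_chain_bound (G : sgraph) (k : nat) : has_chain G k -> (k <= #|G|)%N.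
Proof.
case/existsP => a /existsP[b /andP[+ _]]; rewrite cat_uniq => /andP[ua _].
by rewrite -(size_tuple a) -(card_uniqP ua) max_card.
Qed.

Definition chain_index (G : sgraph) : nat :=
  ex_maxn (has_chain0 G) (@has_chain_bound G).

Definition stable (C : graph_class) : Prop :=
  exists k : nat, forall G : sgraph, C G -> (chain_index G <= k)%N.

Variant pm1 := PlusOne | MinusOne.

Inductive eq_tree (V : Type) :=
| Leaf (value : pm1)
| Node (alpha beta : V -> nat) (left right : eq_tree V).

Fixpoint depth (V : Type) (t : eq_tree V) : nat :=
  match t with
  | Leaf _ => 0%N
  | Node _ _ l r => (maxn (depth l) (depth r)).+1
  end.

Fixpoint walk (V : Type) (t : eq_tree V) (x y : V) : pm1 :=
  match t with
  | Leaf v => v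
  | Node alpha beta l r =>
      if alpha x == beta y then walk r x y else walk l x y
  end.

Definition computed_at_depth (V : finType) (M : V -> V -> pm1) (d : nat) : Prop :=
  exists t : eq_tree V, depth t = d /\ forall x y, walk t x y = M x y.

Lemma computed_at_some_depth (V : finType) (M : V -> V -> pm1) :
  exists d, `[< computed_at_depth M d >].
Proof.
suff [t tM] : exists t : eq_tree V, forall x y, x \in enum V -> walk t x y = M x y.
  exists (depth t); apply/asboolP; exists t; split => // x y.
  by rewrite tM ?mem_enum.
elim: (enum V) => [|v s [t tM]]; first by exists (Leaf V PlusOne).
exists (Node (fun x => nat_of_bool (x == v)) (fun=> 1%N) t
  (Node (fun=> 1%N) (fun y => if M v y is PlusOne then 1%N else 0%N)
    (Leaf V MinusOne) (Leaf V PlusOne))) => x y /=.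
rewrite inE; case: eqVneq => [-> _|_ /= xs] /=; last exact: tM.
by case: (M v y).
Qed.

Definition DEq (V : finType) (M : V -> V -> pm1) : nat :=
  ex_minn (computed_at_some_depth M).

Definition adj (G : sgraph) (x y : G) : pm1 :=
  if edge x y then PlusOne else MinusOne.

Definition DEq_bounded (C : graph_class) : Prop :=
  exists c : nat, forall G : sgraph, C G -> (DEq (@adj G) <= c)%N.

(* Main.v *)
Require Import Defs.
From mathcomp Require Import all_boot all_order all_algebra.
From mathcomp Require Import boolp reals.
From mathcomp Require Import zify lra.

(* A tree of depth [d] for the adjacency matrix cannot describe a long half
   graph: by Ramsey, on a long sub-sequence all off-diagonal queries at the root
   are answered in the same way, so that one subtree describes a half graph.

   Conversely, cut the plane into unit cells. A bounded number of equality
   queries finds the relative position of the cells of [x] and [y], and all pairs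
   of cells in that position are treated in parallel by one tree. For two distinct
   cells the boundaries of the disks around the points [a] of the first cell are
   translates of one concave arc, so two of them cross at most once: for [a] to
   the left of [a'], the points [b] seen by [a] only are to the left of those seen
   by [a'] only. Stability bounds the Littlestone dimension of the set of columns
   [b], and one argues by induction on it. Each row splits the columns in two
   parts, one of which has smaller dimension; complementing if necessary, let this
   be the part seen by the row. Let [P] be a hitting set of the columns of minimum
   size. The trace of a column on [P] is an interval; nested chains of traces are
   half graphs, so their length is bounded and one may assume that the traces form
   an antichain. For a minimum hitting set [Q] of these, every column meets at most
   two points of [Q], and by minimality of [P] the columns seen by a given row meet
   at most five points of [Q] altogether. So five equality queries locate a point
   [q] of [Q] such that only columns seen by [q] remain, and these have smaller
   dimension. *)

Set Implicit Arguments.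
Unset Strict Implicit.
Unset Printing Implicit Defensive.

Import Order.TTheory GRing.Theory Num.Theory.

(** * Half graphs and equality trees *)

(** The head [x] splits the tail into the elements related to it and the others; one class is large
    enough for induction, and [x] extends its list when needed. Only earlier-to-later pairs count,
    so [r] may be asymmetric. *)
Lemma ramsey_pairwise (T : eqType) (r : rel T) m n (s : seq T) :
  2 ^ (m + n) <= size s ->
  exists2 t, subseq t s &
    (size t = m /\ pairwise r t) \/ (size t = n /\ pairwise (fun x y => ~~ r x y) t).
Proof.
have [k] := ubnP (m + n); elim: k m n s => // k IH [|m] [|n] s lt_mn_k s_large.
1-3: by exists [::]; [exact: sub0seq | (left + right)].
case: s s_large => [|x s]; first by rewrite leqn0 expn_eq0.
rewrite addSnnS addnS expnS mul2n -addnn /= => s_large.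
have := count_predC (r x) s; rewrite -!size_filter => size_s.
have [large|small] := leqP (2 ^ (m + n.+1)) (size (filter (r x) s)).
  have [|t sub_t [[szt rt]|[szt rt]]] := IH m n.+1 _ _ large; first by lia.
  - exists (x :: t).
      by rewrite /= eqxx (subseq_trans sub_t (filter_subseq _ _)).
    left; split; rewrite /= ?szt // rt andbT; apply/allP => y /(mem_subseq sub_t).
    by rewrite mem_filter => /andP[].
  - exists t; last by right.
    exact: subseq_trans sub_t (subseq_trans (filter_subseq _ _) (subseq_cons _ _)).
have large : 2 ^ (m.+1 + n) <= size (filter (predC (r x)) s).
  by move: small s_large size_s; rewrite addSnnS addnS; lia.
have [|t sub_t [[szt rt]|[szt rt]]] := IH m.+1 n _ _ large; first by lia.
- exists t; last by left.
  exact: subseq_trans sub_t (subseq_trans (filter_subseq _ _) (subseq_cons _ _)).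
- exists (x :: t).
    by rewrite /= eqxx (subseq_trans sub_t (filter_subseq _ _)).
  right; split; rewrite /= ?szt // rt andbT; apply/allP => y /(mem_subseq sub_t).
  by rewrite mem_filter => /andP[].
Qed.

Lemma ramsey_diagonal (T : eqType) (r : rel T) m (s : seq T) :
  2 ^ (m + m) <= size s ->
  exists t (c : bool), [/\ subseq t s, size t = m & pairwise (fun x y => r x y == c) t].
Proof.
move=> /(@ramsey_pairwise _ r)[t sub_t [[szt rt]|[szt rt]]].
- by exists t, true; split=> //; apply: sub_pairwise rt => x y /eqP.
- by exists t, false; split=> //; apply: sub_pairwise rt => x y /negbTE/eqP.
Qed.

Definition accepts (V : Type) (t : eq_tree V) (x y : V) : bool :=
  if walk t x y is PlusOne then true else false.

Definition half_graph (V : Type) (M : rel V) (s : seq (V * V)) : bool :=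
  pairwise (fun x y => M x.1 y.2 && ~~ M y.1 x.2) s.

Lemma sub_half_graph (V : Type) (M M' : rel V) (r : rel (V * V)) s :
  (forall x y, r x y -> M x.1 y.2 = M' x.1 y.2 /\ M y.1 x.2 = M' y.1 x.2) ->
  pairwise r s -> half_graph M s -> half_graph M' s.
Proof.
move=> MM' rs Ms; have: pairwise (fun x y => r x y && (M x.1 y.2 && ~~ M y.1 x.2)) s.
  by rewrite (pairwise_relI r (fun x y => M x.1 y.2 && ~~ M y.1 x.2)) rs.
by apply: sub_pairwise => x y /andP[/MM'[-> ->]].
Qed.

(** Two Ramsey steps make the answers at the root uniform above and below the diagonal; the 4 leaves
    room to refute opposite answers. *)
Fixpoint half_graph_bound (d : nat) : nat :=
  if d is d'.+1 then
    let m := maxn (half_graph_bound d') 4 in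
    2 ^ (2 ^ (m + m) + 2 ^ (m + m))
  else 2.

Lemma accepts_half_graph (V : eqType) d (t : eq_tree V) s :
  depth t <= d -> half_graph (accepts t) s -> size s < half_graph_bound d.
Proof.
elim: d t s => [|d IH] [v|al be l r] s //=.
- by move=> _; rewrite /accepts; case: s => [|x [|y s]] //=; case: v.
- move=> _ hs; apply: leq_trans (IH (Leaf V v) s _ hs) _ => //.
  apply: leq_trans (leq_maxl _ 4) _.
  apply: leq_trans (ltnW (ltn_expl _ (ltnSn 1))) _; rewrite leq_exp2l //.
  apply: leq_trans (leq_addr _ _) (leq_trans (ltnW (ltn_expl _ (ltnSn 1))) _).
  exact: leq_addr.
rewrite ltnS geq_max => /andP[dl dr]; set m := maxn _ _ => hs.
rewrite ltnNge; apply/negP => /(ramsey_diagonal (fun x y => al x.1 == be y.2)).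
case=> s1 [c1 [sub1 sz1 r1]].
have [s2 [c2 [sub2 sz2 r2]]] : exists t c, [/\ subseq t s1, size t = m
    & pairwise (fun x y => (al y.1 == be x.2) == c) t].
  by apply: ramsey_diagonal; rewrite sz1.
have {}r1 := subseq_pairwise sub2 r1.
have {}hs : half_graph (accepts (Node al be l r)) s2.
  exact: subseq_pairwise (subseq_trans sub2 sub1) hs.
have r12 : pairwise
    (fun x y => ((al x.1 == be y.2) == c1) && ((al y.1 == be x.2) == c2)) s2.
  by rewrite (pairwise_relI (fun x y => (al x.1 == be y.2) == c1)) r1.
(* Opposite answers contradict transitivity: with equality above the diagonal, a_x = b_y, a_x = b_w
   and a_z = b_w give a_z = b_y, an entry below it. *)
have four p : pairwise p s2 -> exists x y z w, [/\ p x y, p y z, p x w & p z w].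
  have: 4 <= size s2 by rewrite sz2 leq_maxr.
  case: s2 {sub2 sz2 r1 r2 r12 hs} => [|x [|y [|z [|w s2]]]] //= _.
  case/and5P => /and4P[xy _ xw _] /and3P[yz _ _] /andP[zw _] _ _.
  by exists x, y, z, w; split.
case: c1 c2 r12 {r1 r2} => -[] r12.
- have: half_graph (accepts r) s2.
    apply: (sub_half_graph _ r12 hs) => x y /andP[/eqP e1 /eqP e2].
    by rewrite /accepts /= e1 e2.
  by move/(IH _ _ dr); rewrite sz2 ltnNge leq_maxl.
- have [x [y [z [w [p01 q12 p03 p23]]]]] := four _ r12.
  by move: p01 q12 p03 p23 => /andP[/eqP/eqP p01 _] /andP[_] /eqP q12 /andP[/eqP/eqP p03 _]
    /andP[/eqP/eqP p23 _]; rewrite p23 -p03 p01 eqxx in q12.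
- have [x [y [z [w [p01 q12 p03 p23]]]]] := four _ r12.
  by move: p01 q12 p03 p23 => /andP[_ /eqP/eqP p01] /andP[/eqP q12 _] /andP[_ /eqP/eqP p03]
    /andP[_ /eqP/eqP p23]; rewrite p01 -p03 p23 eqxx in q12.
- have: half_graph (accepts l) s2.
    apply: (sub_half_graph _ r12 hs) => x y; rewrite !eqbF_neg.
    by move=> /andP[/negbTE e1 /negbTE e2]; rewrite /accepts /= e1 e2.
  by move/(IH _ _ dl); rewrite sz2 ltnNge leq_maxl.
Qed.

(** * Composing equality trees *)

Section EqCost.
Variable V : finType.
Implicit Types (t : eq_tree V) (D : V -> V -> Prop) (M : rel V) (k : V -> nat).

(** [D] is a promise: each query narrows the pairs on which the rest of the tree must be correct. *)
Definition eq_cost (d : nat) D M : Prop :=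
  exists2 t, depth t <= d & forall x y, D x y -> accepts t x y = M x y.

Lemma accepts_node al be (l r : eq_tree V) x y :
  accepts (Node al be l r) x y =
    if al x == be y then accepts r x y else accepts l x y.
Proof. by rewrite /accepts /=; case: ifP. Qed.

Lemma eq_cost_sub d d' D D' M : d <= d' -> (forall x y, D' x y -> D x y) ->
  eq_cost d D M -> eq_cost d' D' M.
Proof.
move=> le_dd' subD [t dt tM]; exists t; first exact: leq_trans le_dd'.
by move=> x y /subD/tM.
Qed.

Lemma eq_cost_const e d D M : (forall x y, D x y -> M x y = e) -> eq_cost d D M.
Proof.
by move=> Me; exists (Leaf V (if e then PlusOne else MinusOne)) => // x y /Me ->; case: e {Me}.
Qed.

Lemma eq_cost_compl d D M : eq_cost d D (fun x y => ~~ M x y) -> eq_cost d D M.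
Proof.
case=> t dt tM; suff [t' dt' tt'] : exists2 t', depth t' = depth t
    & forall x y, accepts t' x y = ~~ accepts t x y.
  by exists t'; [rewrite dt' | move=> x y /tM Mxy; rewrite tt' Mxy negbK].
elim: t {dt tM} => [w|al be l [l' dl ll'] r [r' dr rr']].
  by exists (Leaf V (if w is PlusOne then MinusOne else PlusOne)) => // x y; case: w.
exists (Node al be l' r'); first by rewrite /= dl dr.
by move=> x y; rewrite !accepts_node ll' rr'; case: ifP.
Qed.

Lemma eq_cost_branch k k' d D M :
  eq_cost d (fun x y => D x y /\ k x = k' y) M ->
  eq_cost d (fun x y => D x y /\ k x != k' y) M ->
  eq_cost d.+1 D M.
Proof.
move=> [r dr rM] [l dl lM]; exists (Node k k' l r); first by rewrite /= ltnS geq_max dl.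
move=> x y Dxy; rewrite accepts_node.
by case: (eqVneq (k x) (k' y)) => e; [apply: rM | apply: lM].
Qed.

(* The values exchanged in the tree [T i] are sent through one common tree;
   the extra query replaces the leaf value, which may depend on [i]. *)
Lemma eq_tree_glue k k' d (T : nat -> eq_tree V) : (forall i, depth (T i) <= d) ->
  exists2 t, depth t <= d.+1 &
    forall x y, k x = k' y -> accepts t x y = accepts (T (k x)) x y.
Proof.
elim: d T => [|d IH] T dT.
  exists (Node (fun x => if T (k x) is Leaf PlusOne then 1 else 0) (fun=> 1)
    (Leaf V MinusOne) (Leaf V PlusOne)) => // x y _.
  by rewrite accepts_node; have := dT (k x); case: (T (k x)) => [[]|].
(* A leaf reached early is its own child and its dummy query compares 0 with 0, so it is carried
   down unchanged. *)
pose al t := if t is Node al _ _ _ then al else fun=> 0.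
pose be t := if t is Node _ be _ _ then be else fun=> 0.
pose lt t := if t is Node _ _ l _ then l else t.
pose rt t := if t is Node _ _ _ r then r else t.
have [l dl lT] : exists2 t, depth t <= d.+1 &
    forall x y, k x = k' y -> accepts t x y = accepts (lt (T (k x))) x y.
  apply: (IH (lt \o T)) => i; have := dT i; rewrite /=.
  by case: (T i) => //= _ _ l r; rewrite ltnS geq_max => /andP[].
have [r dr rT] : exists2 t, depth t <= d.+1 &
    forall x y, k x = k' y -> accepts t x y = accepts (rt (T (k x))) x y.
  apply: (IH (rt \o T)) => i; have := dT i; rewrite /=.
  by case: (T i) => //= _ _ l' r; rewrite ltnS geq_max => /andP[].
exists (Node (fun x => al (T (k x)) x) (fun y => be (T (k' y)) y) l r).
  by rewrite /= ltnS geq_max dl.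
move=> x y kxy; rewrite accepts_node lT // rT // -kxy.
by case: (T (k x)) => [w|al' be' l' r'] /=; rewrite ?accepts_node // eqxx.
Qed.

Lemma eq_cost_glue k k' d D M :
  (forall i, eq_cost d (fun x y => D x y /\ k x = i /\ k' y = i) M) ->
  eq_cost d.+1 (fun x y => D x y /\ k x = k' y) M.
Proof.
move=> costM; pose good i t := depth t <= d /\
  forall x y, D x y /\ k x = i /\ k' y = i -> accepts t x y = M x y.
have /choice[T TM] : forall i, exists t, good i t.
  by move=> i; have [t dt tM] := costM i; exists t.
have [t dt tT] := eq_tree_glue k k' (fun i => (TM i).1).
by exists t => // x y [Dxy kxy]; rewrite tT //; apply: (TM _).2.
Qed.

(** The row keys are tried in turn against the column key; a match is settled by gluing, and if none
    matches then [M] is false. *)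
Lemma eq_cost_lookup (ks : nat -> V -> nat) k' n d D M :
  (forall j i, j < n -> eq_cost d (fun x y => D x y /\ ks j x = i /\ k' y = i) M) ->
  (forall x y, D x y -> M x y -> exists2 j, j < n & ks j x = k' y) ->
  eq_cost (d.+1 + n) D M.
Proof.
elim: n D => [|n IH] D costM findM.
  by apply: (@eq_cost_const false) => x y Dxy; apply/negP => /(findM _ _ Dxy)[].
rewrite addnS; apply: (@eq_cost_branch (ks n) k').
  apply: (@eq_cost_sub d.+1 _ (fun x y => D x y /\ ks n x = k' y)) => //.
    exact: leq_addr.
  by apply: eq_cost_glue => i; apply: costM.
apply: IH => [j i lt_jn|x y [Dxy neq] Mxy].
  by apply: (eq_cost_sub (leqnn d) _ (costM j i (ltnW lt_jn))) => x y [[Dxy _] e].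
have [j] := findM x y Dxy Mxy.
by rewrite ltnS leq_eqVlt => /predU1P[->|lt_jn] e; [rewrite e eqxx in neq | exists j].
Qed.

End EqCost.

(** * Ladders and Littlestone dimension *)

Section Ladders.
Variable V : finType.
Implicit Types (A B : {set V}) (M : rel V).

(** Prescribing the diagonal forces distinct rows and distinct columns; complementing [M] swaps the
    two values of [e]. *)
Definition ladder M (e : bool) (s : seq (V * V)) : bool :=
  pairwise (fun x y => (M x.1 y.2 == ~~ e) && (M y.1 x.2 == e)) s &&
  all (fun x => M x.1 x.2 == e) s.

Definition in_block A B (s : seq (V * V)) := all (fun x => (x.1 \in A) && (x.2 \in B)) s.

Definition ladder_free n A B M : Prop :=
  forall e s, in_block A B s -> ladder M e s -> size s < n.

Lemma in_blockS A A' B B' s : A \subset A' -> B \subset B' ->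
  in_block A B s -> in_block A' B' s.
Proof.
move=> /subsetP sA /subsetP sB; apply: sub_all => x /andP[/sA -> /sB ->] //.
Qed.

Lemma ladder_freeS n A A' B B' M : A' \subset A -> B' \subset B ->
  ladder_free n A B M -> ladder_free n A' B' M.
Proof. by move=> sA sB free e s /(in_blockS sA sB)/free; apply. Qed.

Lemma ladder_free_compl n A B M :
  ladder_free n A B M -> ladder_free n A B (fun x y => ~~ M x y).
Proof.
move=> free e s sAB /andP[ps ds]; apply: (free (~~ e)) => //; apply/andP; split.
  by apply: sub_pairwise ps => x y; do 2 case: (M _ _); case: (e).
by apply: sub_all ds => x; case: (M _ _); case: (e).
Qed.

(* The columns [B], as sets of rows in [A], have Littlestone dimension at least [d]. *)
Fixpoint shatters M A (d : nat) B : bool :=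
  if d is d'.+1 then
    [exists a in A, shatters M A d' [set b in B | M a b] &&
                    shatters M A d' [set b in B | ~~ M a b]]
  else B != set0.

Lemma shattersS M A A' d B B' : A \subset A' -> B \subset B' ->
  shatters M A d B -> shatters M A' d B'.
Proof.
move=> sA; elim: d B B' => [|d IH] B B' sB /=.
  by move=> /set0Pn[x xB]; apply/set0Pn; exists x; apply: (subsetP sB).
move=> /exists_inP[a aA /andP[h1 h0]]; apply/exists_inP; exists a; first exact: (subsetP sA).
by apply/andP; split; [apply: IH h1 | apply: IH h0]; apply/subsetP => x;
  rewrite !inE => /andP[/(subsetP sB) -> ->].
Qed.

Lemma shatters_neq0 M A d B : shatters M A d B -> B != set0.
Proof.
elim: d B => [|d IH] B //= /exists_inP[a _ /andP[/IH/set0Pn[x]]].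
by rewrite inE => /andP[xB _] _; apply/set0Pn; exists x.
Qed.

(** Ramsey for binary trees with nodes coloured by [A1] and [A2]. If the root is in [A1], either a
    child contains a deep enough [A2] tree, or both contain [A1] trees, which the root joins. *)
Lemma shatters_split M A A1 A2 m n B : A \subset A1 :|: A2 ->
  shatters M A (m + n) B -> shatters M A1 m B \/ shatters M A2 n B.
Proof.
move=> sA; have [k] := ubnP (m + n).
elim: k m n B => // k IH [|m] [|n] B lt_mn sh; try by have := shatters_neq0 sh; auto.
move: sh; rewrite addSnnS addnS /= => /exists_inP[a aA /andP[h1 h0]].
have sub (p : pred V) : [set b in B | p b] \subset B.
  by apply/subsetP => x; rewrite inE => /andP[].
have /setUP[aA1|aA2] := subsetP sA _ aA.
- have [||h1'|/(shattersS (subxx _) (sub _))] :=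
    IH m n.+1 [set b in B | M a b]; [lia|exact| |by right].
  have [||h0'|/(shattersS (subxx _) (sub _))] :=
    IH m n.+1 [set b in B | ~~ M a b]; [lia|exact| |by right].
  by left; apply/exists_inP; exists a => //; apply/andP.
- have [||/(shattersS (subxx _) (sub _))|h1'] :=
    IH m.+1 n [set b in B | M a b]; [lia|by rewrite addSnnS| by left|].
  have [||/(shattersS (subxx _) (sub _))|h0'] :=
    IH m.+1 n [set b in B | ~~ M a b]; [lia|by rewrite addSnnS| by left|].
  by right; apply/exists_inP; exists a => //; apply/andP.
Qed.

Fixpoint shatter_bound (k : nat) : nat :=
  if k is k'.+1 then (shatter_bound k').+1 + (shatter_bound k').+1 else 0.

(** Fix a column [b] and colour the rows by their value at [b]. The root [a] of a monochromatic tree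
    gives a first rung [(a, b)]; the ladder continues in the child whose columns differ from [b] at
    [a]. *)
Lemma shatters_ladder M p q A B : shatters M A (shatter_bound (p + q)) B ->
  exists e s, [/\ in_block A B s, ladder M e s & size s = if e then q else p].
Proof.
have [k] := ubnP (p + q); elim: k p q A B => // k IH [|p] [|q] A B lt_pq sh.
1-2: by exists false, [::].
  by exists true, [::].
move: sh; rewrite addSnnS addnS [shatter_bound _.+1]/= => sh.
have /set0Pn[b bB] := shatters_neq0 sh.
have sA : A \subset [set a in A | ~~ M a b] :|: [set a in A | M a b].
  by apply/subsetP => a aA; rewrite !inE aA; case: (M a b).
have subA (r : pred V) : [set a in A | r a] \subset A.
  by apply/subsetP => x; rewrite inE => /andP[].
have subB (r : pred V) : [set a in B | r a] \subset B.
  by apply/subsetP => x; rewrite inE => /andP[].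
have [/exists_inP[a]|/exists_inP[a]] := shatters_split sA sh;
  rewrite inE => /andP[aA Mab] /andP[h1 h0].
- have [|[] [s [sAB lad szs]]] := IH p q.+1 _ _ _ h1; first by lia.
    by exists true, s; split=> //; apply: in_blockS sAB.
  exists false, ((a, b) :: s); split; last by rewrite /= szs.
    by rewrite /in_block /= aA bB; apply: in_blockS sAB.
  case/andP: lad => ps ds; rewrite /ladder /= ps ds (negbTE Mab) eqxx !andbT.
  by apply: sub_all sAB => x; rewrite !inE => /andP[/andP[_ /negbTE ->] /andP[_ ->]].
- rewrite -addSnnS in h0; have [|[] [s [sAB lad szs]]] := IH p.+1 q _ _ _ h0; first by lia.
    exists true, ((a, b) :: s); split; last by rewrite /= szs.
      by rewrite /in_block /= aA bB; apply: in_blockS sAB.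
    case/andP: lad => ps ds; rewrite /ladder /= ps ds Mab eqxx !andbT.
    by apply: sub_all sAB => x; rewrite !inE => /andP[/andP[_ ->] /andP[_ /negbTE ->]].
  by exists false, s; split=> //; apply: in_blockS sAB.
Qed.

Lemma ladder_free_shatters n A B M : ladder_free n A B M ->
  ~~ shatters M A (shatter_bound (n + n)) B.
Proof.
move=> free; apply/negP => /shatters_ladder[e [s [sAB lad]]].
by have := free e s sAB lad; case: e {lad} => /[swap] ->; rewrite ltnn.
Qed.

End Ladders.

(** * Relations whose rows cross at most once *)

(** The comparison of [u a] and [u a'] is weak, so rows with equal [u] are nested: exchanging them
    would reverse the strict conclusion. *)
Definition crossing_ordered (R : realDomainType) (V : finType) (u v : V -> R)
    (A B : {set V}) (M : rel V) : Prop :=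
  forall a a' b b', a \in A -> a' \in A -> b \in B -> b' \in B ->
  (u a <= u a')%R -> M a b -> ~~ M a' b -> M a' b' -> ~~ M a b' -> (v b < v b')%R.

Lemma crossing_orderedS (R : realDomainType) (V : finType) (u v : V -> R)
    (A A' B B' : {set V}) (M : rel V) :
  A' \subset A -> B' \subset B ->
  crossing_ordered u v A B M -> crossing_ordered u v A' B' M.
Proof.
move=> /subsetP sA /subsetP sB ord a a' b b' /sA aA /sA a'A /sB bB /sB b'B.
exact: ord.
Qed.

(** Complementing exchanges the columns seen by only one of two rows, hence the sign of [v]. *)
Lemma crossing_ordered_compl (R : realDomainType) (V : finType) (u v : V -> R)
    (A B : {set V}) (M : rel V) :
  crossing_ordered u v A B M ->
  crossing_ordered u (fun b => - v b)%R A B (fun a b => ~~ M a b).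
Proof.
move=> ord a a' b b' aA a'A bB b'B uaa' nab; rewrite negbK => a'b na'b'.
by rewrite negbK => ab'; rewrite ltrN2; apply: (ord a a').
Qed.

(** * Minimum hitting sets and the traces of columns on them *)

Section HittingSets.
Variables (V : finType) (M : rel V).
Implicit Types P L : {set V}.

Definition hits P L := [forall b in L, exists p in P, M p b].

Lemma hitsP P L : reflect {in L, forall b, exists2 p, p \in P & M p b} (hits P L).
Proof.
apply: (iffP forall_inP) => h b /h; last by move=> pb; apply/exists_inP.
by move/exists_inP.
Qed.

Lemma exists_min_hits P L : hits P L -> exists Q : {set V},
  [/\ Q \subset P, hits Q L &
      forall Q' : {set V}, Q' \subset P -> hits Q' L -> #|Q| <= #|Q'|].
Proof.
move=> hitP; have hP : (P \subset P) && hits P L by rewrite subxx.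
pose Q := [arg min_(Q < P | (Q \subset P) && hits Q L) #|Q|].
exists Q; rewrite {}/Q; case: arg_minnP => // Q /andP[sQ hQ] minQ.
by split=> // Q' sQ' hQ'; apply: minQ; rewrite sQ'.
Qed.

Lemma min_hits_private P L : hits P L ->
  (forall P' : {set V}, P' \subset P -> hits P' L -> #|P| <= #|P'|) ->
  {in P, forall p, exists c, [/\ c \in L, M p c & {in P, forall q, M q c -> q = p}]}.
Proof.
move=> hP minP p pP; have nh : ~~ hits (P :\ p) L.
  apply/negP => /(minP _ (subD1set _ _)).
  by rewrite (cardsD1 p P) pP ltnn.
case/forall_inPn: nh => c cL /exists_inPn npc; exists c.
have priv : {in P, forall q, M q c -> q = p}.
  move=> q qP qc; apply/eqP; apply: contraTT qc => neq; apply: npc.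
  by rewrite !inE neq.
split=> //; have /hitsP/(_ c cL)[q qP qc] := hP.
by rewrite -(priv q qP qc).
Qed.

End HittingSets.

Arguments hitsP {V M P L}.

Lemma exists_argmin (R : realDomainType) (V : finType) (u : V -> R) (K : {set V}) :
  K != set0 ->
  exists2 q, q \in K & {in K, forall r, (u q <= u r)%R}.
Proof.
move=> /set0Pn[q0 q0K]; pose q := [arg min_(q < q0 in K) u q]%O.
by exists q; rewrite {}/q; case: arg_minP => // q qK minq; apply: minq.
Qed.

Lemma exists_argmax (R : realDomainType) (V : finType) (u : V -> R) (K : {set V}) :
  K != set0 ->
  exists2 q, q \in K & {in K, forall r, (u r <= u q)%R}.
Proof.
move=> /(exists_argmin (fun x => - u x)%R)[q qK minq].
by exists q => // r /minq; rewrite lerN2.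
Qed.

Section SparseRows.
Variables (R : realDomainType) (V : finType) (u v : V -> R) (A B : {set V}) (M : rel V).
Hypothesis ord : crossing_ordered u v A B M.

Section Traces.
Variable P : {set V}.
Hypothesis sPA : P \subset A.
Hypothesis hitP : hits M P B.
Hypothesis minP : forall P' : {set V}, P' \subset A -> hits M P' B -> #|P| <= #|P'|.

Definition trace b := [set p in P | M p b].

(** If [q] missed [b], a private column of [q] would lie right of [b] by comparison with [p], and
    left of it by comparison with [r]. *)
Lemma trace_convex p q r b : p \in P -> q \in P -> r \in P -> b \in B ->
  (u p <= u q)%R -> (u q <= u r)%R -> M p b -> M r b -> M q b.
Proof.
move=> pP qP rP bB pq qr pb rb; apply/negPn/negP => nqb.
have [|c [cB qc privc]] := min_hits_private hitP _ qP.
  by move=> P' sP'; apply: minP; apply: subset_trans sPA.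
have nc s : s \in P -> M s b -> ~~ M s c.
  by move=> sP sb; apply: contra nqb => /(privc _ sP) <-.
have A_ := subsetP sPA.
have := ord (A_ _ pP) (A_ _ qP) bB cB pq pb nqb qc (nc _ pP pb).
have := ord (A_ _ qP) (A_ _ rP) cB bB qr qc (nc _ rP rb) rb nqb.
by move=> /lt_trans h /h; rewrite ltxx.
Qed.

(* Were the gap larger, exchanging it for [a] would give a smaller hitting set. *)
Lemma trace_gap a b b' t s : a \in A -> b \in B -> b' \in B -> M a b -> M a b' ->
  t \in P -> s \in P -> M t b -> M s b' ->
  #|[set p in P | [&& ~~ M p b, ~~ M p b', (u t <= u p)%R & (u p <= u s)%R]]| <= 1.
Proof.
move=> aA bB b'B ab ab' tP sP tb sb'; set G := [set p in P | _].
have A_ := subsetP sPA.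
have: #|P| <= #|a |: (P :\: G)|.
  apply: minP.
    by apply/subsetP => x /setU1P[->|/setDP[/A_]].
  apply/hitsP => c cB.
  have [p pP pc] := hitsP hitP c cB.
  have [pG|pG] := boolP (p \in G); last by exists p; rewrite // in_setU1 in_setD pP pG orbT.
  have [/exists_inP[q qPG qc]|/exists_inPn noPG] := boolP [exists q in P :\: G, M q c].
    by exists q => //; rewrite in_setU1 qPG orbT.
  exists a; first by rewrite setU11.
  apply/negPn/negP => nac.
  move: pG; rewrite inE pP /= => /and4P[npb npb' tp ps].
  have ntc : ~~ M t c by apply: noPG; rewrite !inE tP tb.
  have nsc : ~~ M s c by apply: noPG; rewrite !inE sP sb' !andbF.
  (* In the order [v], [c] lies strictly between [b] and [b']. As [a] sees both but not [c],
     comparing it with [p] contradicts one bound, whichever side of [p] it is on. *)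
  have vbc := ord (A_ _ tP) (A_ _ pP) bB cB tp tb npb pc ntc.
  have vcb' := ord (A_ _ pP) (A_ _ sP) cB b'B ps pc nsc sb' npb'.
  have [ua|ua] := leP (u a) (u p).
    by have := lt_trans vcb' (ord aA (A_ _ pP) b'B cB ua ab' npb' pc nac); rewrite ltxx.
  by have := lt_trans vbc (ord (A_ _ pP) aA cB bB (ltW ua) pc nac ab npb); rewrite ltxx.
have sGP : G \subset P by apply/subsetP => x; rewrite inE => /andP[].
rewrite cardsU1 cardsDS //; have := subset_leq_card sGP.
by move: (_ \notin _) #|P| #|G| => [] m k; clear; lia.
Qed.

Section Level.
Variable L : {set V}.
Hypothesis sLB : L \subset B.
Hypothesis antichain : {in L &, forall b c, ~~ (trace c \proper trace b)}.
Variable Q : {set V}.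
Hypothesis sQP : Q \subset P.
Hypothesis hitQ : hits M Q L.
Hypothesis minQ : forall Q' : {set V}, Q' \subset P -> hits M Q' L -> #|Q| <= #|Q'|.

(* A point strictly between two other hits of [b] has a private column in [L],
   whose trace is, by convexity, strictly inside that of [b]. *)
Lemma card_level_hits b : b \in L -> #|[set q in Q | M q b]| <= 2.
Proof.
move=> bL; set K := [set q in Q | _]; rewrite leqNgt; apply/negP => K2.
have K0 : K != set0 by by rewrite -card_gt0; apply: leq_trans K2.
have [q qK minq] := exists_argmin u K0; have [r rK maxr] := exists_argmax u K0.
have /subsetPn[p pK] : ~~ (K \subset [set q; r]).
  apply/negP => /subset_leq_card; rewrite leqNgt; case/negP.
  by apply: leq_trans K2; rewrite cards2; case: (_ != _).
rewrite !inE negb_or => /andP[pq pr].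
have := minq _ pK; have := maxr _ pK => upr uqp.
move: pK qK rK; rewrite !inE => /andP[pQ pb] /andP[qQ qb] /andP[rQ rb].
have P_ := subsetP sQP; have B_ := subsetP sLB.
have [|c [cL pc privc]] := min_hits_private hitQ _ pQ.
  by move=> Q' sQ'; apply: minQ; apply: subset_trans sQP.
have nqc : ~~ M q c by apply: contra pq => /(privc _ qQ) ->.
have nrc : ~~ M r c by apply: contra pr => /(privc _ rQ) ->.
apply: (negP (antichain bL cL)); apply/properP; split; last first.
  by exists q; rewrite !inE P_.
apply/subsetP => s; rewrite !inE => /andP[sP sc]; rewrite sP /=.
(* The trace of [c] contains [p] but neither [q] nor [r], so convexity keeps it between them, where
   all of [P] sees [b]. *)
have [sq|qs] := leP (u s) (u q).
  by rewrite (trace_convex sP (P_ _ qQ) (P_ _ pQ) (B_ _ cL) sq uqp sc pc) in nqc.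
have [rs|sr] := leP (u r) (u s).
  by rewrite (trace_convex (P_ _ pQ) (P_ _ rQ) sP (B_ _ cL) upr rs pc sc) in nrc.
exact: (trace_convex (P_ _ qQ) sP (P_ _ rQ) (B_ _ bL) (ltW qs) (ltW sr)).
Qed.

Definition candidates a := [set q in Q | [exists b in L, M a b && M q b]].

(** 5 = 2 + 2 + 1: with [b] and [b'] witnessing the extreme candidates, each candidate sees [b], or
    sees [b'], or lies in the gap of [trace_gap]. *)
Lemma card_candidates a : a \in A -> #|candidates a| <= 5.
Proof.
move=> aA; have [->|K0] := eqVneq (candidates a) set0; first by rewrite cards0.
have [t tK mint] := exists_argmin u K0; have [s sK maxs] := exists_argmax u K0.
have P_ := subsetP sQP; have B_ := subsetP sLB.
move: tK sK; rewrite !inE => /andP[tQ /exists_inP[b bL /andP[ab tb]]].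
move=> /andP[sQ /exists_inP[b' b'L /andP[ab' sb']]].
have gap := trace_gap aA (B_ _ bL) (B_ _ b'L) ab ab' (P_ _ tQ) (P_ _ sQ) tb sb'.
have := card_level_hits bL; have := card_level_hits b'L; move: gap.
set G := [set _ in _ | _]; set H' := [set _ in _ | _]; set H := [set _ in _ | _].
move=> G1 H2 H2'; have sK : candidates a \subset G :|: H :|: H'.
  apply/subsetP => q qK; have := mint _ qK; have := maxs _ qK => uqs utq.
  move: qK; rewrite !inE => /andP[qQ _].
  by rewrite qQ P_ // uqs utq /= andbT; case: (M q b); case: (M q b').
have := subset_leq_card sK; have := cardsU (G :|: H) H'; have := cardsU G H.
move: G1 H2 H2'; move: #|G| #|H| #|_ :|: H| #|_ :|: H'| #|_ :&: H| #|_ :&: H'|.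
move: #|candidates a|.
by clear; lia.
Qed.

Lemma eq_cost_level c :
  {in A, forall q, eq_cost c (fun a b => [/\ a \in A, b \in B & M q b]) M} ->
  eq_cost (c.+1 + 5) (fun a b => a \in A /\ b \in L) M.
Proof.
move=> costA; pose g b := odflt b [pick q in Q | M q b].
have gP b : b \in L -> g b \in Q /\ M (g b) b.
  move=> bL; rewrite /g; case: pickP => [q /andP[] //|none].
  by have [q qQ qb] := hitsP hitQ b bL; have := none q; rewrite qQ qb.
(* The default [a] past the last candidate is harmless: any match leaves only columns seen by one
   point [g b]. *)
apply: (@eq_cost_lookup _ (fun j a => pickle (nth a (enum (candidates a)) j))
  (fun b => pickle (g b))) => [j i _|a b [aA bL] Mab].
  have [/exists_inP[b bL /eqP gb]|/exists_inPn nob] :=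
    boolP [exists b in L, pickle (g b) == i].
    have [gbQ _] := gP b bL.
    apply: (eq_cost_sub (leqnn c) _ (costA _ (subsetP (subset_trans sQP sPA) _ gbQ))).
    move=> a b' [[aA b'L] [_]]; rewrite -gb => /(pcan_inj pickleK) <-.
    by split=> //; [apply: (subsetP sLB) | case: (gP b' b'L)].
  by apply: (@eq_cost_const _ true) => a b [[_ bL] [_ e]]; have := nob _ bL; rewrite e eqxx.
have [gbQ Mgb] := gP b bL.
have gK : g b \in candidates a by rewrite inE gbQ; apply/exists_inP; exists b; rewrite ?Mab.
exists (index (g b) (enum (candidates a))); last by rewrite nth_index ?mem_enum.
apply: leq_trans (card_candidates aA); rewrite cardE index_mem mem_enum //.
Qed.

End Level.

(** Each round peels off the columns with minimal traces, an antichain; a chain among the others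
    extends downwards, so the bound [h] drops by one. *)
Lemma eq_cost_rounds c h (L : {set V}) : L \subset B ->
  {in A, forall q, eq_cost c (fun a b => [/\ a \in A, b \in B & M q b]) M} ->
  (forall s : seq V, all (fun b : V => b \in L) s ->
    pairwise (fun b b' => trace b \proper trace b') s -> size s <= h) ->
  eq_cost (h + (c.+1 + 5)) (fun a b => a \in A /\ b \in L) M.
Proof.
move=> + costA; elim: h L => [|h IH] L sLB nest.
  apply: (@eq_cost_const _ true) => a b [_ bL].
  by have := nest [:: b]; rewrite /= bL => /(_ erefl erefl).
pose minimal b := [forall c in L, ~~ (trace c \proper trace b)].
have sub (p : pred V) : [set b in L | p b] \subset L.
  by apply/subsetP => x; rewrite inE => /andP[].
rewrite addSn; apply: (@eq_cost_branch _ (fun=> 1) (fun b => minimal b : nat)).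
  have sL1 : [set b in L | minimal b] \subset B := subset_trans (sub _) sLB.
  have hit1 : hits M P [set b in L | minimal b].
    by apply/hitsP => b /(subsetP sL1); apply: (hitsP hitP).
  have [Q [sQP hitQ minQ]] := exists_min_hits hit1.
  apply: (eq_cost_sub _ _ (eq_cost_level sL1 _ sQP hitQ minQ costA)).
  - exact: leq_addl.
  - by move=> a b [[aA bL]]; rewrite inE bL; case: (minimal b).
  - move=> b b'; rewrite !inE => /andP[_ /forall_inP minb] /andP[b'L _].
    exact: minb.
apply: (eq_cost_sub (leqnn _) _ (IH [set b in L | ~~ minimal b] _ _)).
- by move=> a b [[aA bL]]; rewrite inE bL; case: (minimal b).
- exact: subset_trans (sub _) sLB.
move=> [|b s] //= /andP[+ sL] ps; rewrite inE => /andP[bL /forall_inPn[b' b'L]].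
rewrite negbK => b'b; rewrite -ltnS; apply: (nest [:: b', b & s]) => /=.
  by rewrite b'L bL; apply: sub_all sL => x; rewrite inE => /andP[].
rewrite b'b ps andbT /=; case/andP: ps => bs _.
by apply: sub_all bs => x; apply: proper_trans.
Qed.

(** A row gained from one trace to the next forms a rung with the column it misses. It sees all
    later columns, and rows chosen later miss this one, since traces grow. The last column has no
    rung. *)
Lemma nested_traces_ladder (s : seq V) : s != [::] -> all (fun b : V => b \in B) s ->
  pairwise (fun b b' => trace b \proper trace b') s ->
  exists l, [/\ in_block A B l, ladder M false l & (size l).+1 = size s].
Proof.
suff: s != [::] -> all (fun b : V => b \in B) s ->
    pairwise (fun b b' => trace b \proper trace b') s ->
  exists l, [/\ all (fun x => (x.1 \in P) && (x.2 \in s)) l, ladder M false l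
    & (size l).+1 = size s].
  move=> H s0 sB ps; have [l [lPs lad szl]] := H s0 sB ps; exists l; split=> //.
  apply: sub_all lPs => x /andP[/(subsetP sPA) ->].
  exact: (allP sB).
elim: s => // b [|b' s] IH _; first by exists [::].
move=> /andP[bB sB]; rewrite pairwise_cons => /andP[bs ps].
have [l [lPs lad szl]] := IH isT sB ps.
have /andP[/properP[_ [p]]] := bs; rewrite !inE => /andP[pP pb'].
rewrite pP /= => npb _.
have up x : x \in b' :: s -> trace b' \subset trace x.
  rewrite inE => /predU1P[-> //|xs].
  by move: ps; rewrite pairwise_cons => /andP[/allP/(_ x xs)/proper_sub].
exists ((p, b) :: l); split; last by rewrite /= szl.
  rewrite /= pP mem_head /=; apply: sub_all lPs => x /andP[-> xs].
  by rewrite inE xs orbT.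
case/andP: lad => pl dl; rewrite /ladder /= pl dl (negbTE npb) !andbT.
apply/allP => x xl; have /andP[xP xs] := allP lPs x xl.
have := subsetP (up _ xs) p; rewrite !inE pP pb' => /(_ isT) /= ->.
have := subsetP (proper_sub (allP bs _ xs)) x.1; rewrite !inE xP /=.
by have /eqP -> := allP dl x xl; case: (M x.1 b) => // /(_ isT).
Qed.

End Traces.

End SparseRows.

(** The first query discards columns seen by no row, so that [A] hits the rest. A chain of n + 1
    traces would give a ladder of length n, so n rounds suffice. *)
Lemma eq_cost_sparse_rows (R : realDomainType) (V : finType) (u v : V -> R)
    (A B : {set V}) (M : rel V) n c :
  crossing_ordered u v A B M -> ladder_free n A B M ->
  {in A, forall q, eq_cost c (fun a b => [/\ a \in A, b \in B & M q b]) M} ->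
  eq_cost (n + c + 7) (fun a b => a \in A /\ b \in B) M.
Proof.
move=> ord free costA; pose B' := [set b in B | [exists a in A, M a b]].
have sB' : B' \subset B by apply/subsetP => b; rewrite inE => /andP[].
rewrite addnS; apply: (@eq_cost_branch _ (fun=> 1) (fun b => b \in B' : nat)); last first.
  apply: (@eq_cost_const _ false) => a b [[aA bB] nb].
  apply/negP => Mab; move: nb; rewrite inE bB.
  by rewrite (introT exists_inP (ex_intro2 _ _ a aA Mab)).
have hitA : hits M A B' by apply/hitsP => b; rewrite inE => /andP[_ /exists_inP].
have [P [sPA hitP minP]] := exists_min_hits hitA.
have ord' := crossing_orderedS (subxx A) sB' ord.
have costA' : {in A, forall q, eq_cost c (fun a b => [/\ a \in A, b \in B' & M q b]) M}.
  move=> q qA; apply: (eq_cost_sub (leqnn c) _ (costA q qA)) => a b [aA bB' qb].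
  by split=> //; apply: (subsetP sB').
have rounds := @eq_cost_rounds _ _ _ _ _ _ _ ord' P sPA hitP minP c n B' (subxx _) costA'.
apply: (eq_cost_sub _ _ (rounds _)) => //.
- by clear; lia.
- by move=> a b [[aA _]]; case: (b \in B').
move=> [|b s] // sB ps.
have [|l [lAB lad <-]] := nested_traces_ladder sPA _ sB ps; first by [].
exact: free (in_blockS (subxx A) sB' lAB) lad.
Qed.

Lemma eq_cost_shatters (R : realDomainType) (V : finType) (u v : V -> R)
    (A B : {set V}) (M : rel V) n d :
  crossing_ordered u v A B M -> ladder_free n A B M -> ~~ shatters M A d B ->
  eq_cost (d * (n + 8)) (fun a b => a \in A /\ b \in B) M.
Proof.
elim: d A B => [|d IH] A B ord free /=.
  by rewrite negbK => /eqP ->; apply: (@eq_cost_const _ true) => a b []; rewrite inE.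
move=> /exists_inPn nsh; pose small a := ~~ shatters M A d [set b in B | M a b].
have subA (r : pred V) : [set a in A | r a] \subset A.
  by apply/subsetP => x; rewrite inE => /andP[].
have subB (r : pred V) : [set a in B | r a] \subset B.
  by apply/subsetP => x; rewrite inE => /andP[].
have e : (n + d * (n + 8) + 7).+1 = d.+1 * (n + 8) by rewrite mulSn; lia.
have cost (A' B' : {set V}) : A' \subset A -> B' \subset B -> ~~ shatters M A d B' ->
    eq_cost (d * (n + 8)) (fun a b => a \in A' /\ b \in B') M.
  move=> sA sB nshB; apply: IH; first exact: crossing_orderedS ord.
    exact: ladder_freeS free.
  by apply: contra nshB; apply: shattersS.
rewrite -e; apply: (@eq_cost_branch _ (fun a => small a : nat) (fun=> 1)).
  apply: (@eq_cost_sub _ (n + d * (n + 8) + 7) _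
    (fun a b => a \in [set a in A | small a] /\ b \in B)) => //.
    by move=> a b [[aA bB]]; rewrite inE aA; case: (small a).
  apply: eq_cost_sparse_rows.
  - exact: crossing_orderedS ord.
  - exact: ladder_freeS free.
  move=> q; rewrite inE => /andP[qA smq].
  have costq := cost _ _ (subA small) (subB (M q)) smq.
  apply: (eq_cost_sub (leqnn _) _ costq) => a b [aA bB qb].
  by rewrite [b \in _]inE bB qb.
apply: (@eq_cost_sub _ (n + d * (n + 8) + 7) _
    (fun a b => a \in [set a in A | ~~ small a] /\ b \in B)) => //.
  by move=> a b [[aA bB]]; rewrite inE aA; case: (small a).
apply: eq_cost_compl; apply: (@eq_cost_sparse_rows _ _ u (fun b => - v b)%R).
- exact: crossing_ordered_compl (crossing_orderedS (subA _) (subxx B) ord).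
- exact: ladder_free_compl (ladder_freeS (subA _) (subxx B) free).
move=> q; rewrite inE => /andP[qA]; rewrite negbK => bigq.
have := nsh q qA; rewrite bigq /= => smq.
have := cost _ _ (subA (fun a => ~~ small a)) (subB (fun b => ~~ M q b)) smq.
case=> t dt tM; apply: eq_cost_compl; exists t => // a b [aA bB qb].
by rewrite negbK; apply: tM; split=> //; rewrite inE bB.
Qed.

(** * Unit disk graphs *)

Section DiskGeometry.
Local Open Scope ring_scope.
Variable R : realFieldType.

Lemma lt_sqr_same_side (a c : R) : 0 <= c -> (a - c) ^+ 2 > a ^+ 2 -> c > 2 * a.
Proof.
move=> c0 h; rewrite ltNge; apply/negP => le2a.
have : 0 <= c * (2 * a - c) by rewrite mulr_ge0 // subr_ge0.
lra.
Qed.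

(** Centre 1 is lower than centre 2 yet nearer to point 3, so x3 < (x1 + x2) / 2 <= x2. Point 4 is
    higher than point 3 yet nearer to centre 2, so x2 < (x3 + x4) / 2 <= x3. *)
Lemma arcs_cross_up (x1 y1 x2 y2 x3 y3 x4 y4 : R) :
  x1 <= x2 -> x4 <= x3 -> y1 < y2 -> y3 < y4 -> y2 < y3 ->
  (x1 - x3) ^+ 2 + (y1 - y3) ^+ 2 < 4 -> 4 <= (x2 - x3) ^+ 2 + (y2 - y3) ^+ 2 ->
  (x2 - x4) ^+ 2 + (y2 - y4) ^+ 2 < 4 -> False.
Proof.
move=> x12 x43 y12 y34 y23 d13 d23 d24.
have s_gt0 : 0 < (y2 - y1) * ((y3 - y1) + (y3 - y2)) by rewrite mulr_gt0; lra.
have t_gt0 : 0 < (y4 - y3) * ((y4 - y2) + (y3 - y2)) by rewrite mulr_gt0; lra.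
have p_big : x2 - x1 > 2 * (x3 - x1).
  by apply: lt_sqr_same_side; lra.
have : x3 - x4 > 2 * (x2 - x4) by apply: lt_sqr_same_side; lra.
lra.
Qed.

(* The part of the boundary of a disk of radius 2 above its centre is a translate
   of one concave arc, and two translates of it cross at most once. *)
Lemma arcs_cross_once (x1 y1 x2 y2 x3 y3 x4 y4 : R) :
  x1 <= x2 -> y1 < y3 -> y2 < y3 -> y1 < y4 -> y2 < y4 ->
  (x1 - x3) ^+ 2 + (y1 - y3) ^+ 2 < 4 -> 4 <= (x2 - x3) ^+ 2 + (y2 - y3) ^+ 2 ->
  (x2 - x4) ^+ 2 + (y2 - y4) ^+ 2 < 4 -> 4 <= (x1 - x4) ^+ 2 + (y1 - y4) ^+ 2 ->
  x3 < x4.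
Proof.
move=> x12 y13 y23 y14 y24 d13 d23 d24 d14; rewrite ltNge; apply/negP => x43.
have : 0 <= (x2 - x1) * (x3 - x4) by rewrite mulr_ge0; lra.
(* The four distance bounds add up to (x2 - x1) (x3 - x4) < (y2 - y1) (y4 - y3), so centres and
   points are ordered alike in height. *)
move=> x_dir; have : 0 < (y2 - y1) * (y4 - y3) by lra.
have [y12|y12] := ltP y1 y2.
  rewrite pmulr_rgt0 ?subr_gt0 // => y34.
  exact: (@arcs_cross_up x1 y1 x2 y2 x3 y3 x4 y4).
have [->|y21] := eqVneq y2 y1; first by rewrite subrr mul0r ltxx.
have {y12}y21 : y2 < y1 by rewrite lt_neqAle y21.
rewrite nmulr_rgt0 ?subr_lt0 // => y43.
(* Reflection in the vertical axis exchanges the two centres and the two points. *)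
by apply: (@arcs_cross_up (- x2) y2 (- x1) y1 (- x4) y4 (- x3) y3); lra.
Qed.

End DiskGeometry.

(** * Chain-index and ladders *)

Section Chains.
Variable G : sgraph.

Lemma has_chain_index k : has_chain G k -> k <= chain_index G.
Proof. by rewrite /chain_index; case: ex_maxnP => m _ maxm /maxm. Qed.

Lemma chain_indexP : has_chain G (chain_index G).
Proof. by rewrite /chain_index; case: ex_maxnP. Qed.

Lemma has_chain_half_graph k : has_chain G k ->
  exists2 s, half_graph (@edge G) s & size s = k.
Proof.
case/existsP => a /existsP[b /andP[_ /forallP ab]].
exists [seq (tnth a i, tnth b i) | i <- enum 'I_k]; last by rewrite size_map size_enum_ord.
rewrite /half_graph pairwise_map.
have: pairwise (fun i j : 'I_k => i < j) (enum 'I_k).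
  rewrite -(pairwise_map (@nat_of_ord k) ltn) val_enum_ord.
  by rewrite -(sorted_pairwise ltn_trans) iota_ltn_sorted.
apply: sub_pairwise => i j ij /=; have /forallP/(_ j)/implyP/(_ ij) := ab i.
by rewrite (edge_sym (tnth b i)).
Qed.

Lemma half_graph_has_chain s : half_graph (@edge G) s ->
  uniq (unzip1 s ++ unzip2 s) -> has_chain G (size s).
Proof.
move=> hs us; apply/existsP; exists (map_tuple fst (in_tuple s)).
apply/existsP; exists (map_tuple snd (in_tuple s)); rewrite us /=.
apply/forallP => i; apply/forallP => j; apply/implyP => ij; rewrite !tnth_map.
case: s hs {us} i j ij => [|x s] hs i j ij; first by case: i {ij}.
rewrite !(tnth_nth x) /= (edge_sym (nth x (x :: s) i).2).
by apply: (pairwiseP x hs) => //; apply: ltn_ord.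
Qed.

Lemma ladder_has_chain (A B : {set G}) e s : [disjoint A & B] ->
  in_block A B s -> ladder (@edge G) e s -> has_chain G (size s).
Proof.
move=> dAB sAB /andP[ps ds].
have u1 : uniq (unzip1 s).
  rewrite uniq_pairwise pairwise_map; apply: sub_in_pairwise ds ps => x y _ /eqP yy /=.
  case/andP=> /eqP xy _; apply/eqP => e1; rewrite e1 yy in xy.
  by case: (e) xy.
have u2 : uniq (unzip2 s).
  rewrite uniq_pairwise pairwise_map; apply: sub_in_pairwise ds ps => x y /eqP xx _ /=.
  case/andP=> /eqP xy _; apply/eqP => e1; rewrite -e1 xx in xy.
  by case: (e) xy.
have dis x : x \in unzip1 s -> x \notin unzip2 s.
  case/mapP => y ys ->; apply/mapP => -[z zs yz].
  have /andP[yA _] := allP sAB y ys; have /andP[_ zB] := allP sAB z zs.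
  by have := disjointFr dAB yA; rewrite yz zB.
case: e ps {ds} => ps; last first.
  apply: half_graph_has_chain; last first.
    rewrite cat_uniq u1 u2 andbT; apply/hasPn => x x2; apply/negP => /dis.
    by rewrite x2.
  by apply: sub_pairwise ps => x y /andP[/eqP -> /eqP ->].
(* The relation holds on and below the diagonal: exchange the two sides. *)
rewrite -(size_map (fun x => (x.2, x.1))); apply: half_graph_has_chain.
  rewrite /half_graph pairwise_map; apply: sub_pairwise ps => x y /=.
  by rewrite !(edge_sym _.2) => /andP[/eqP -> /eqP ->].
rewrite /unzip1 /unzip2 -!map_comp cat_uniq u1 u2 andbT.
by apply/hasPn => x /dis.
Qed.

Lemma chain_index_ladder_free (A B : {set G}) : [disjoint A & B] ->
  ladder_free (chain_index G).+1 A B (@edge G).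
Proof.
move=> dAB e s sAB lad; rewrite ltnS; apply: has_chain_index.
exact: ladder_has_chain dAB sAB lad.
Qed.

End Chains.

Definition block_cost n := shatter_bound (n + n) * (n + 8).

Section UnitDisk.
Variables (R : realType) (G : sgraph).
Local Notation n := (chain_index G).+1.

(** [U] and [W] stand for the coordinates up to exchange and sign, so that the case of [A] below [B]
    covers all pairs of distinct cells. *)
Lemma eq_cost_disk_block (U W : G -> R) (A B : {set G}) :
  (forall x y, x != y -> edge x y = ((U x - U y) ^+ 2 + (W x - W y) ^+ 2 < 4)%R) ->
  {in A & B, forall a b, W a < W b}%R ->
  eq_cost (block_cost n) (fun a b => a \in A /\ b \in B) (@edge G).
Proof.
move=> edgeE WAB.
have neq a b : a \in A -> b \in B -> a != b.
  by move=> aA bB; apply: contraTneq (WAB a b aA bB) => ->; rewrite ltxx.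
have dAB : [disjoint A & B].
  rewrite disjoints_subset; apply/subsetP => a aA; rewrite inE.
  by apply/negP => /(neq _ _ aA)/eqP.
have free := chain_index_ladder_free dAB.
apply: (@eq_cost_shatters _ _ U U) => //; last exact: ladder_free_shatters.
move=> a a' b b' aA a'A bB b'B uaa'.
rewrite !edgeE ?neq // -!leNgt => ab a'b a'b' ab'.
by apply: (arcs_cross_once uaa' _ _ _ _ ab a'b a'b' ab'); apply: WAB.
Qed.

Variable phi : G -> 'rV[R]_2.
Hypothesis phiP : forall x y : G, x != y -> edge x y <-> (norm2 (phi x - phi y) < 2)%R.

Let X x := phi x 0%R 0%R.
Let Y x := phi x 0%R 1%R.

Lemma edge_coords (x y : G) : x != y ->
  edge x y = ((X x - X y) ^+ 2 + (Y x - Y y) ^+ 2 < 4)%R.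
Proof.
move=> xy; have -> : edge x y = (norm2 (phi x - phi y) < 2)%R by apply/idP/idP => /(phiP xy).
rewrite /norm2 big_ord_recl big_ord1 !mxE.
have -> : (2 = Num.sqrt 4 :> R)%R.
  by rewrite (_ : 4 = 2 ^+ 2)%R ?sqrtr_sqr ?ger0_norm //; lra.
by rewrite ltr_sqrt // (_ : lift ord0 ord0 = 1%R) //; apply: val_inj.
Qed.

Let cX x := Num.floor (X x).
Let cY x := Num.floor (Y x).

Lemma floor_lt_lt (a b : R) : (Num.floor a < Num.floor b -> a < b)%R.
Proof. by rewrite !ltNge; apply: contra; apply: le_floor. Qed.

Lemma floor_near (a b c : R) : ((a - b) ^+ 2 + c ^+ 2 < 4)%R ->
  (-2 <= Num.floor b - Num.floor a <= 2)%R.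
Proof.
move=> ab; have c0 := sqr_ge0 c.
have := floor_le a; have := floor_le b; have := floorD1_gt a; have := floorD1_gt b.
rewrite !rmorphD /= => a1 b1 a0 b0.
have lo : (a - b < 2)%R by rewrite ltNge; apply/negP => ?; nra.
have hi : (-2 < a - b)%R by rewrite ltNge; apply/negP => ?; nra.
have : ((Num.floor b)%:~R < (Num.floor a + 3)%:~R :> R)%R by rewrite rmorphD /=; lra.
have : ((Num.floor a)%:~R < (Num.floor b + 3)%:~R :> R)%R by rewrite rmorphD /=; lra.
by rewrite !ltr_int; lia.
Qed.

Lemma floor_eq_dist (a b : R) : Num.floor a = Num.floor b -> ((a - b) ^+ 2 < 1)%R.
Proof.
move=> ab; have := floor_le a; have := floor_le b; have := floorD1_gt a; have := floorD1_gt b.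
rewrite ab rmorphD /=; nra.
Qed.

(** The number [j] below 25 encodes in base 5 an offset with entries from -2 to 2, as floors of
    adjacent points differ by at most 2. *)
Let cell_shift j x := pickle (cX x + (j %/ 5)%:Z - 2, cY x + (j %% 5)%:Z - 2)%R.
Let cell x := pickle (cX x, cY x).

Lemma eq_cost_unit_disk :
  eq_cost ((block_cost n).+1 + 25).+1 (fun _ _ => True) (@edge G).
Proof.
apply: (@eq_cost_branch _ pickle pickle).
  apply: (@eq_cost_const _ false) => x y [_ /(pcan_inj pickleK) ->].
  exact: edge_irrefl.
apply: (@eq_cost_lookup _ cell_shift cell) => [j i _|x y [_ neq] xy]; last first.
  have {}neq : x != y by apply: contraNneq neq => ->.
  move: xy; rewrite edge_coords // => near.
  have nX := floor_near near; rewrite addrC in near; have nY := floor_near near.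
  pose dx := `|(cX y - cX x + 2)%R|%N; pose dy := `|(cY y - cY x + 2)%R|%N.
  have dx5 : dx < 5 by move: nX; rewrite /dx /cX; lia.
  have dy5 : dy < 5 by move: nY; rewrite /dy /cY; lia.
  exists (dx * 5 + dy); first by lia.
  rewrite /cell_shift /cell divnMDl // divn_small // addn0 modnMDl modn_small //.
  by congr (pickle (_, _)); [move: nX; rewrite /dx /cX | move: nY; rewrite /dy /cY]; lia.
pose A := [set a | cell_shift j a == i]; pose B := [set b | cell b == i].
set ox : int := ((j %/ 5)%:Z - 2)%R; set oy : int := ((j %% 5)%:Z - 2)%R.
have off : {in A & B, forall a b, cX b = cX a + ox /\ cY b = cY a + oy}%R.
  move=> a b; rewrite !inE => /eqP <- /eqP/(pcan_inj pickleK)[-> ->].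
  by rewrite !addrA.
have block (U W : G -> R) :
  (forall x y, x != y -> edge x y = ((U x - U y) ^+ 2 + (W x - W y) ^+ 2 < 4)%R) ->
  {in A & B, forall a b, W a < W b}%R ->
  eq_cost (block_cost n)
    (fun x y => (True /\ pickle x != pickle y) /\ cell_shift j x = i /\ cell y = i) (@edge G).
  move=> edgeE WAB; apply: (eq_cost_sub (leqnn _) _ (eq_cost_disk_block edgeE WAB)).
  by move=> a b [_ [/eqP aA /eqP bB]]; rewrite !inE.
have [oy_gt0|oy_lt0|oy0] := ltrgtP 0%R oy.
- apply: (block X Y); first exact: edge_coords.
  move=> a b aA bB; apply: floor_lt_lt; rewrite -/(cY a) -/(cY b).
  by have [_ ->] := off a b aA bB; rewrite ltrDl.
- apply: (block X (fun x => - Y x)%R).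
    by move=> x y /edge_coords ->; rewrite -opprD sqrrN.
  move=> a b aA bB; rewrite ltrN2; apply: floor_lt_lt; rewrite -/(cY a) -/(cY b).
  by have [_ ->] := off a b aA bB; rewrite gtrDl.
have [ox_gt0|ox_lt0|ox0] := ltrgtP 0%R ox.
- apply: (block Y X); first by move=> x y /edge_coords ->; rewrite addrC.
  move=> a b aA bB; apply: floor_lt_lt; rewrite -/(cX a) -/(cX b).
  by have [-> _] := off a b aA bB; rewrite ltrDl.
- apply: (block Y (fun x => - X x)%R).
    by move=> x y /edge_coords ->; rewrite -opprD sqrrN addrC.
  move=> a b aA bB; rewrite ltrN2; apply: floor_lt_lt; rewrite -/(cX a) -/(cX b).
  by have [-> _] := off a b aA bB; rewrite gtrDl.
(* Within one cell both coordinates differ by less than 1, so the squared distance is below 2 and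
   distinct vertices are adjacent. *)
apply: (@eq_cost_const _ true) => a b [[_ neq] [/eqP aA /eqP bB]].
have [] := off a b; rewrite ?inE // -ox0 -oy0 !addr0 => eX eY.
rewrite edge_coords; last by apply: contraNneq neq => ->.
have := floor_eq_dist eX; have := floor_eq_dist eY.
rewrite -[(X b - X a)%R]opprB -[(Y b - Y a)%R]opprB !sqrrN; lra.
Qed.

End UnitDisk.

Lemma accepts_adj (G : sgraph) (t : eq_tree G) :
  (forall x y, accepts t x y = edge x y) <-> (forall x y, walk t x y = adj x y).
Proof.
split=> tG x y; have := tG x y; rewrite /accepts /adj.
  by case: walk => <-.
by move=> ->; case: edge.
Qed.

Lemma DEq_le (G : sgraph) d : DEq (@adj G) <= d <-> eq_cost d (fun _ _ => True) (@edge G).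
Proof.
rewrite /DEq; case: ex_minnP => m /asboolP[t [dt /accepts_adj tG]] minm; split.
  by move=> md; exists t => [|x y _]; rewrite ?dt ?tG.
case=> t' dt' t'G; apply: leq_trans dt'; apply: minm; apply/asboolP.
by exists t'; split=> //; apply/accepts_adj => x y; apply: t'G.
Qed.

Theorem theorem4p13 (R : realType) (C : graph_class)
    (C_unit_disk : forall G : sgraph, C G -> unit_disk R G) :
  DEq_bounded C <-> stable C.
Proof.
split=> [[c Cc]|[k Ck]].
  exists (half_graph_bound c) => G /Cc/DEq_le[t dt tG].
  have [s hs <-] := has_chain_half_graph (chain_indexP G).
  apply/ltnW/(accepts_half_graph dt); apply: sub_pairwise hs => x y.
  by rewrite !tG.
(* The maximum over all possible chain-indices avoids monotonicity of [block_cost]. *)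
exists (\max_(n < k.+1) ((block_cost n.+1).+1 + 25).+1) => G CG; apply/DEq_le.
have [phi phiP] := C_unit_disk G CG.
apply: eq_cost_sub (eq_cost_unit_disk phiP) => //.
have kG : chain_index G < k.+1 by rewrite ltnS; apply: Ck.
exact: (@leq_bigmax _ (fun n : 'I_k.+1 => ((block_cost n.+1).+1 + 25).+1) (Ordinal kG)).
Qed.
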